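(* For fixed $\lambda_\ell>0$ and $r_{\mathrm s}>0$, as the vehicular density $\lambda\to\infty$ the idle probability converges to $\exp(-4\lambda_\ell r_{\mathrm s})$; consequently the UAV activation probability $p_{\mathrm a}=1-p_{\mathrm{idle}}$ satisfies $$\lim_{\lambda\to\infty}p_{\mathrm a}=1-\exp(-4\lambda_\ell r_{\mathrm s}).$$ This limit equals the probability that at least one road of the Manhattan Poisson line process intersects the disk of radius $r_{\mathrm s}$ centred at the origin.
   Context: Roads: a Manhattan Poisson line process with density $\lambda_\ell>0$, i.e. horizontal lines $\{y=\rho_i\}$ and vertical lines $\{x=\rho'_j\}$, where $\{\rho_i\}$ and $\{\rho'_j\}$ are independent homogeneous Poisson point processes (PPPs) of intensity $\lambda_\ell$ on $\mathbb R$. Vehicles: conditionally on the roads, each road independently carries a homogeneous one-dimensional PPP of intensity $\lambda>0$. Blockage: with $H>0$ (UAV altitude) and $a,b>0$, $$p_{\mathsf L}(r,H)=\frac{1}{1+a\exp\!\left(-b\left[\frac{180}{\pi}\arctan(H/r)-a\right]\right)}$$ (with $\arctan(H/0)=\pi/2$). Each vehicle at horizontal distance $r$ from the origin is detectable (line-of-sight) independently with probability $p_{\mathsf L}(r,H)$. The idle probability $p_{\mathrm{idle}}$ is the probability that the disk of radius $r_{\mathrm s}$ centred at the origin (the location of the typical UAV) contains no detectable vehicle; it is given by $$p_{\mathrm{idle}}=\exp\!\left(4\lambda_\ell\left(\int_0^{r_{\mathrm s}}e^{-\Lambda(\rho)}d\rho-r_{\mathrm s}\right)\right),\qquad \Lambda(\rho)=2\int_0^{\sqrt{r_{\mathrm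 s}^2-\rho^2}}\lambda\,p_{\mathsf L}(\sqrt{x^2+\rho^2},H)\,dx.$$ *)

(* Defs.v *)
From HB Require Import structures.
From mathcomp Require Import all_boot all_order all_algebra.
From mathcomp Require Import all_classical all_reals all_analysis.

Set Implicit Arguments.
Unset Strict Implicit.
Unset Printing Implicit Defensive.

Import Order.TTheory GRing.Theory Num.Theory.
Import numFieldNormedType.Exports.

Local Open Scope classical_set_scope.
Local Open Scope ring_scope.

Section probability_notions.
Context (R : realType) (d : measure_display) (T : measurableType d).
Variable P : probability T R.

Definition sigma_of (K : Type) (X : K -> {RV P >-> R}) : set (set T) :=
  <<s [set X p.1 @^-1` p.2 | p in [set p : K * set R | measurable p.2] ] >>.

Definition mutually_independent (I : Type) (F : I -> set (set T)) : Prop :=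
  forall (n : nat) (s : 'I_n -> I), injective s ->
  forall E : 'I_n -> set T, (forall j, F (s j) (E j)) ->
  P (\bigcap_j E j) = (\prod_(j < n) fine (P (E j)))%:E.

(* The point process is given by an enumeration [X] of its points. *)
Definition point_count (X : nat -> {RV P >-> R}) (B : set R) (w : T) : \bar R :=
  (\sum_(i <oo) (\1_B (X i w))%:E)%E.

(* Unlike [poisson_pmf], this is also correct at [m = 0], where it is the
   Dirac mass at [0] (Lebesgue-null sets contain almost surely no point). *)
Definition poisson_weight (m : R) (k : nat) : R :=
  m ^+ k / k`!%:R * expR (- m).

(* Homogeneous Poisson point process on the line: the numbers of points in
   pairwise disjoint Borel sets of finite measure are independent Poisson
   variables with means [lam * |B j|]. *)
Definition poisson_process (lam : R) (X : nat -> {RV P >-> R}) : Prop :=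
  forall (n : nat) (B : 'I_n -> set R) (c : 'I_n -> nat),
    (forall j, measurable (B j)) ->
    (forall j, (lebesgue_measure (B j) < +oo)%E) ->
    trivIset setT B ->
    P [set w | forall j, point_count X (B j) w = (c j)%:R%:E] =
    (\prod_(j < n)
       poisson_weight (lam * fine (lebesgue_measure (B j))) (c j))%:E.

(* Conditionally on the sigma-algebra [G], the events [D s] are independent
   and [D s] has (random, [G]-measurable) probability [q s]. *)
Definition conditionally_bernoulli (S : Type) (G : set (set T))
    (D : S -> set T) (q : S -> T -> R) : Prop :=
  forall (n : nat) (s : 'I_n -> S), injective s ->
  forall (e : 'I_n -> bool) (A : set T), G A ->
    P (A `&` \bigcap_j (if e j then D (s j) else ~` D (s j))) =
    (\int[P]_(w in A)
       (\prod_(j < n) (if e j then q (s j) w else 1 - q (s j) w))%:E)%E.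

End probability_notions.

Section geometry.
Context (R : realType).

Definition norm2 (p : R * R) : R := Num.sqrt (p.1 ^+ 2 + p.2 ^+ 2).

Definition disk (rs : R) : set (R * R) := [set p | norm2 p <= rs].

Inductive orientation := Horizontal | Vertical.

Definition road_line (o : orientation) (rho : R) : set (R * R) :=
  match o with
  | Horizontal => [set p | p.2 = rho]
  | Vertical => [set p | p.1 = rho]
  end.

(* Point of [road_line o rho] with coordinate [x] along the road. *)
Definition on_road (o : orientation) (rho x : R) : R * R :=
  match o with
  | Horizontal => (x, rho)
  | Vertical => (rho, x)
  end.

(* [arctan (H / r)], with the convention [arctan (H / 0) = pi / 2]; division
   by zero would give [0] instead. *)
Definition elevation (H r : R) : R := if r == 0 then pi / 2 else atan (H / r).

Definition p_los (a b H r : R) : R :=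
  (1 + a * expR (- b * (180 / pi * elevation H r - a)))^-1.

End geometry.

(* [road o i] is the coordinate of the [i]-th road of orientation [o],
   [vehicle o i k] the coordinate of the [k]-th vehicle along that road, and
   [detectable (o, i, k)] the event that this vehicle is in line of sight. *)
Record network (R : realType) := Network {
  net_display : measure_display;
  net_space : measurableType net_display;
  net_prob : probability net_space R;
  road : orientation -> nat -> {RV net_prob >-> R};
  vehicle : orientation -> nat -> nat -> {RV net_prob >-> R};
  detectable : orientation * nat * nat -> set net_space
}.

Arguments detectable {R} N s : rename.

Section network_model.
Context (R : realType).
Implicit Type N : network R.

Inductive component := Roads of orientation | Vehicles of orientation & nat.

Definition component_points N (c : component) :
    nat -> {RV net_prob N >-> R} :=
  match c with
  | Roads o => road N o
  | Vehicles o i => vehicle N o i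
  end.

Definition positions_sigma N : set (set (net_space N)) :=
  sigma_of (fun p : component * nat => component_points N p.1 p.2).

Arguments positions_sigma : clear implicits.

Definition vehicle_position N (s : orientation * nat * nat)
    (w : net_space N) : R * R :=
  let: (o, i, k) := s in on_road o (road N o i w) (vehicle N o i k w).

Arguments vehicle_position : clear implicits.

(* The joint independence in [net_independent] encodes both the independence
   of the two road processes and the conditional law of the vehicles: given
   the roads, the vehicle processes are independent, with a law that does not
   depend on the roads. *)
Record is_network (lam_l lam a b H : R) N : Prop := IsNetwork {
  net_roads : forall o, poisson_process lam_l (road N o);
  net_vehicles : forall o i, poisson_process lam (vehicle N o i);
  net_independent : mutually_independent (net_prob N)
    (fun c => sigma_of (component_points N c));
  net_detectable_measurable : forall s, measurable (detectable N s);
  net_detectable : conditionally_bernoulli (net_prob N) (positions_sigma N)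
    (detectable N) (fun s w => p_los a b H (norm2 (vehicle_position N s w)))
}.

Definition idle_event (rs : R) N : set (net_space N) :=
  [set w | forall s,
     disk rs (vehicle_position N s w) -> ~ detectable N s w].

Arguments idle_event : clear implicits.

Definition p_idle (rs : R) N : R := fine (net_prob N (idle_event rs N)).

Definition p_active (rs : R) N : R := 1 - p_idle rs N.

Definition road_in_disk (rs : R) N : set (net_space N) :=
  [set w | exists o i, road_line o (road N o i w) `&` disk rs !=set0].

Arguments road_in_disk : clear implicits.

Definition p_road_in_disk (rs : R) N : R :=
  fine (net_prob N (road_in_disk rs N)).

Definition Lambda (lam a b H rs rho : R) : R :=
  2 * \int[lebesgue_measure]_(x in `[0, Num.sqrt (rs ^+ 2 - rho ^+ 2)])
        (lam * p_los a b H (Num.sqrt (x ^+ 2 + rho ^+ 2))).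

Definition p_idle_closed_form (lam_l lam a b H rs : R) : R :=
  expR (4 * lam_l *
    ((\int[lebesgue_measure]_(rho in `[0, rs])
        expR (- Lambda lam a b H rs rho)) - rs)).

End network_model.

(* Main.v *)
Require Import Defs.
From mathcomp Require Import all_boot all_order all_algebra.
From mathcomp Require Import all_classical all_reals all_analysis.
From mathcomp Require Import measurable_realfun lra ring.

Import Order.TTheory GRing.Theory Num.Theory.
Import numFieldNormedType.Exports.

Local Open Scope classical_set_scope.
Local Open Scope ring_scope.

(** The line-of-sight probability is bounded below by a constant [p_los_min]
    that depends on neither the distance nor [lam], which makes the closed form of the
    idle probability unnecessary for its limit.
    If no road meets the disk, the UAV is idle; this has probability
    [expR (- (4 * lam_l * rs))].  Conversely, for [r < rs] let [i] be the first
    road with coordinate in [[- r, r]].  The part of this road at abscissa in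
    [[0, delta]], [delta = sqrt (rs^2 - r^2)], lies in the disk; cut it into
    [n] windows.  Some window is empty with probability at most
    [n * expR (- lam * delta / n)]; otherwise the first vehicles of the
    windows are all undetected, with probability at most [(1 - p_los_min)^n].
    Let [lam] tend to infinity, then [n], then let [r] tend to [rs]. *)

(* The integral of a nonnegative function is a supremum over the simple
   functions below it, hence monotone even on non-measurable functions; this
   avoids proving [Lambda] measurable. *)
Lemma ge0_le_integral_nomeas {d} {T : measurableType d} {R : realType}
    (mu : {measure set T -> \bar R}) (D : set T) (f g : T -> \bar R) :
  (forall x, D x -> (0 <= f x)%E) -> (forall x, D x -> (f x <= g x)%E) ->
  (\int[mu]_(x in D) f x <= \int[mu]_(x in D) g x)%E.
Proof.
move=> f0 fg.
have g0 x : D x -> (0 <= g x)%E by move=> Dx; exact: le_trans (f0 _ Dx) (fg _ Dx).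
rewrite !ge0_integralE//; apply: le_ereal_sup => _ [h /= hf <-].
exists h => // x /=; apply: (le_trans (hf x)).
by rewrite /patch; case: ifPn => // /set_mem; exact: fg.
Qed.

(** * Events generated by random points, and void probabilities *)

Section sigma_of_theory.
Context {R : realType} {d} {T : measurableType d} {P : probability T R}.

Lemma sigma_of_preimage {K : Type} {X : K -> {RV P >-> R}} k B :
  measurable B -> sigma_of X (X k @^-1` B).
Proof. by move=> mB; apply: sub_sigma_algebra; exists (k, B). Qed.

Lemma sigma_of_measurable {K : Type} {X : K -> {RV P >-> R}} :
  sigma_of X `<=` measurable.
Proof.
apply: smallest_sub; first exact: sigma_algebra_measurable.
by move=> _ [[k B] /= mB <-]; exact: measurable_funPTI.
Qed.

Lemma sigma_of_comp {K K' : Type} {X : K -> {RV P >-> R}} (f : K' -> K) :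
  sigma_of (fun k => X (f k)) `<=` sigma_of X.
Proof.
apply: sub_sigma_algebra2 => _ [[k B] /= mB <-].
by exists (f k, B).
Qed.

Lemma sigma_ofI {K : Type} {X : K -> {RV P >-> R}} A B :
  sigma_of X A -> sigma_of X B -> sigma_of X (A `&` B).
Proof. exact: (@measurableI _ (g_sigma_algebraType _)). Qed.

Lemma sigma_ofC {K : Type} {X : K -> {RV P >-> R}} A :
  sigma_of X A -> sigma_of X (~` A).
Proof. exact: sigma_algebraC. Qed.

Lemma sigma_of_bigcap {K : Type} {X : K -> {RV P >-> R}} (A : nat -> set T) :
  (forall i, sigma_of X (A i)) -> sigma_of X (\bigcap_i A i).
Proof.
by move=> sA; apply: (@bigcap_measurableType _ (g_sigma_algebraType _)) => i _; exact: sA.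
Qed.

Lemma sigma_of_bigcap_fin {K : Type} {X : K -> {RV P >-> R}} (I : finType)
    (A : I -> set T) :
  (forall i, sigma_of X (A i)) -> sigma_of X (\bigcap_i A i).
Proof.
move=> sA; apply: (@fin_bigcap_measurable _ (g_sigma_algebraType _)) => [|i _].
  exact: finite_finset.
exact: sA.
Qed.

Lemma sigma_of_seqDU {K : Type} {X : K -> {RV P >-> R}} (A : nat -> set T) i :
  (forall i, sigma_of X (A i)) -> sigma_of X (seqDU A i).
Proof.
by move=> sA; apply: (@seqDU_measurable _ (g_sigma_algebraType _)).
Qed.

Definition avoids (X : nat -> {RV P >-> R}) (B : set R) : set T :=
  \bigcap_i ~` (X i @^-1` B).

(** First refers to the enumeration, not to the order of the line. [seqDU] makes the events of
    different indices disjoint, so that probabilities can be summed over the index. *)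
Definition first_hit (X : nat -> {RV P >-> R}) (B : set R) : nat -> set T :=
  seqDU (fun i => X i @^-1` B).

Lemma first_hitE X B : \bigcup_i first_hit X B i = ~` avoids X B.
Proof.
rewrite -seqDU_bigcup_eq /avoids setC_bigcap.
by under [RHS]eq_bigcupr do rewrite setCK.
Qed.

Lemma sigma_of_avoids X B : measurable B -> sigma_of X (avoids X B).
Proof.
by move=> mB; apply: sigma_of_bigcap => i; apply: sigma_ofC; exact: sigma_of_preimage.
Qed.

Lemma sigma_of_first_hit X B i :
  measurable B -> sigma_of X (first_hit X B i).
Proof.
by move=> mB; apply: sigma_of_seqDU => j; exact: sigma_of_preimage.
Qed.

Lemma point_count_eq0 X B : [set w | point_count X B w = 0%E] = avoids X B.
Proof.
apply/seteqP; split=> w /=.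
- move=> X0 i _ /= BX; suff : (1 <= point_count X B w)%E by rewrite X0 lee_fin ler10.
  apply: le_trans (nneseries_lim_ge i.+1 _); last first.
    by move=> j _; rewrite lee_fin.
  by rewrite big_nat_recr//= indicE mem_set// leeDr// sume_ge0.
- move=> vw; rewrite /point_count eseries0// => i _ _.
  by rewrite indicE memNset//; exact: vw.
Qed.

(** This is the Poisson law for a single set and the count 0, whose weight reduces to the
    exponential factor. *)
Lemma poisson_avoids {lam X B} : poisson_process lam X -> measurable B ->
  (lebesgue_measure B < +oo)%E ->
  P (avoids X B) = (expR (- (lam * fine (lebesgue_measure B))))%:E.
Proof.
move=> poisX mB Boo.
have := poisX 1%N (fun=> B) (fun=> 0%N) (fun=> mB) (fun=> Boo).
rewrite big_ord1 /poisson_weight expr0 fact0 divr1 mul1r => <-.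
  rewrite -point_count_eq0; congr (P _); apply/seteqP; split=> w /=.
    by move=> ->.
  by move=> /(_ ord0).
by move=> i j _ _ _; rewrite (ord1 i) (ord1 j).
Qed.

(** Plays the role of conditioning on a countable family of disjoint events [E' i]: subadditivity
    over the [E i] and additivity over the [E' i] turn a bound on each piece into a bound on the
    union. *)
Lemma measure_bigcup_pieces (I : countType) (E E' : I -> set T) (F : set T)
    (c : R) : 0 <= c -> measurable F -> (forall i, measurable (E i)) ->
  (forall i, measurable (E' i)) -> trivIset setT E' ->
  (forall i, E' i `<=` F) -> (forall i, P (E i) <= c%:E * P (E' i))%E ->
  (P (\bigcup_i E i) <= c%:E * P F)%E.
Proof.
move=> c0 mF mE mE' tE' E'F EE'.
(* Both families are carried over to [nat] along [pickle], with the empty set at the codes that name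
   no index. *)
pose ext (G : I -> set T) n := if @pickle_inv I n is Some i then G i else set0.
have mext G : (forall i, measurable (G i)) -> forall n, measurable (ext G n).
  by move=> mG n; rewrite /ext; case: pickle_inv.
have extE G : \bigcup_i G i = \bigcup_n ext G n.
  apply/seteqP; split=> w [n _ Gw].
    by exists (pickle n) => //; rewrite /ext pickleK_inv.
  by move: Gw; rewrite /ext; case: pickle_inv => // j Gw; exists j.
have text : trivIset setT (ext E').
  move=> m n _ _; rewrite /ext.
  case um : (@pickle_inv I m) => [i|]; last by case=> w [].
  case un : (@pickle_inv I n) => [j|]; last by case=> w [].
  move=> /(tE' _ _ Logic.I Logic.I) ij.
  have <- : pickle i = m by have := @pickle_invK I m; rewrite um.
  by have <- : pickle j = n by [have := @pickle_invK I n; rewrite un]; rewrite ij.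
rewrite extE; apply: (@le_trans _ _ (\sum_(n <oo) P (ext E n))%E).
  apply: measure_sigma_subadditive => //; first exact: mext.
  by apply: bigcup_measurable => n _; exact: mext.
apply: (@le_trans _ _ (\sum_(n <oo) (c%:E * P (ext E' n)))%E).
  apply: lee_nneseries => // n _; rewrite /ext; case: pickle_inv => [i|].
    exact: EE'.
  by rewrite !measure0 mule0.
rewrite nneseriesZl//.
rewrite lee_wpmul2l ?lee_fin//.
rewrite -measure_semi_bigcup//; last 2 first.
- by move=> n; exact: mext.
- by apply: bigcup_measurable => n _; exact: mext.
rewrite -extE; apply: le_measure; rewrite ?inE//.
  by rewrite extE; apply: bigcup_measurable => n _; exact: mext.
by apply: bigcup_sub => n _; exact: E'F.
Qed.

End sigma_of_theory.

(** * Bounds on the line-of-sight probability that are uniform in the distance *)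

Definition p_los_min {R : realType} (a b : R) : R := (1 + a * expR (b * a))^-1.

Section line_of_sight.
Context {R : realType} {a b H : R}.
Hypotheses (a0 : 0 < a) (b0 : 0 < b) (H0 : 0 < H).

Lemma p_los_min_gt0 : 0 < p_los_min a b.
Proof. by rewrite invr_gt0 addr_gt0// mulr_gt0// expR_gt0. Qed.

Lemma p_los_min_lt1 : p_los_min a b < 1.
Proof.
by rewrite invf_lt1 ?ltrDl ?addr_gt0// mulr_gt0// expR_gt0.
Qed.

Lemma elevation_ge0 r : 0 <= r -> 0 <= elevation H r.
Proof.
move=> r0; rewrite /elevation; case: ifPn => _; first by rewrite divr_ge0// pi_ge0.
by rewrite -atan0 le_atan// divr_ge0// ltW.
Qed.

(** [p_los] increases with the elevation angle, which is nonnegative, and [p_los_min] is the value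
    of the formula at angle 0. *)
Lemma p_los_ge r : 0 <= r -> p_los_min a b <= p_los a b H r.
Proof.
move=> r0; rewrite lef_pV2 ?posrE ?addr_gt0 ?mulr_gt0 ?expR_gt0//.
rewrite lerD2l ler_pM2l// ler_expR mulrBr !mulNr opprK gerDr oppr_le0.
by rewrite pmulr_rge0// mulr_ge0 ?divr_ge0 ?pi_ge0 ?elevation_ge0.
Qed.

Lemma p_los_le1 r : p_los a b H r <= 1.
Proof.
by rewrite invf_le1 ?lerDl ?addr_gt0// ?mulr_ge0 ?mulr_gt0 ?expR_ge0 ?expR_gt0// ltW.
Qed.

End line_of_sight.

(** * Subdivision of a road segment into windows *)

Section window.
Context {R : realType}.

(** The intervals are half-open so that consecutive windows share no endpoint. *)
Definition window (delta : R) (n j : nat) : set R :=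
  `]delta * j%:R / n%:R, delta * j.+1%:R / n%:R]%classic.

Lemma window_measure (delta : R) n j : 0 < delta -> (0 < n)%N ->
  lebesgue_measure (window delta n j) = (delta / n%:R)%:E.
Proof.
move=> d0 n0; rewrite lebesgue_measure_itv/= lte_fin.
rewrite ltr_pM2r ?invr_gt0 ?ltr0n// ltr_pM2l// ltr_nat ltnSn -EFinD.
by congr EFin; rewrite -mulrBl -mulrBr -natrB// subSnn mulr1.
Qed.

Lemma window_inj {delta : R} {n j j' : nat} {x : R} : 0 < delta -> (0 < n)%N ->
  window delta n j x -> window delta n j' x -> j = j'.
Proof.
move=> d0 n0.
have wlt i i' : window delta n i x -> window delta n i' x -> (i <= i')%N.
  rewrite /window/= !in_itv/= => /andP[ix _] /andP[_ xi'].
  have := lt_le_trans ix xi'.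
  by rewrite ltr_pM2r ?invr_gt0 ?ltr0n// ltr_pM2l// ltr_nat ltnS.
by move=> wj wj'; apply/eqP; rewrite eqn_leq !wlt.
Qed.

Lemma window_sub {delta : R} {n j : nat} {x : R} : 0 < delta -> (j < n)%N ->
  window delta n j x -> 0 <= x <= delta.
Proof.
move=> d0 jn; rewrite /window/= in_itv/= => /andP[jx xj].
have n0 : 0 < n%:R :> R by rewrite ltr0n (leq_ltn_trans _ jn).
apply/andP; split.
  by apply: le_trans (ltW jx); rewrite divr_ge0 ?mulr_ge0// ltW.
by rewrite (le_trans xj)// ler_pdivrMr// ler_pM2l// ler_nat.
Qed.

End window.

Lemma mutually_independent2 {R : realType} {d} {T : measurableType d}
    {P : probability T R} {I : Type} {F : I -> set (set T)} c c' A B :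
  mutually_independent P F -> c <> c' -> F c A -> F c' B ->
  measurable A -> measurable B -> P (A `&` B) = (P A * P B)%E.
Proof.
move=> indF cc' FA FB mA mB.
have := indF 2%N (fun j => if j == ord0 then c else c').
have inj2 : injective (fun j : 'I_2 => if j == ord0 then c else c').
  move=> i j /=; case: (eqVneq i ord0) => [->|i0]; case: (eqVneq j ord0) => [->|j0]//.
  - by move=> /esym.
  - by move=> _; case: i j i0 j0 => [[|[|//]] ?] [[|[|//]] ?] //= _ _; apply/val_inj.
move=> /(_ inj2 (fun j => if j == ord0 then A else B)).
have -> : \bigcap_j (if j == ord0 :> 'I_2 then A else B) = A `&` B.
  apply/seteqP; split=> w.
    by move=> AB; split; [exact: (AB ord0)|exact: (AB ord_max)].
  by move=> [wA wB] j _; case: ifP.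
move=> ->; last by move=> j; case: ifP.
by rewrite big_ord_recl big_ord1/= EFinM !fineK ?fin_num_measure.
Qed.

(** * Idle probability when a given road crosses the disk *)

Section network_bounds.
Context {R : realType} {lam_l lam a b H rs : R} {N : network R}.
Hypotheses (rs0 : 0 < rs) (a0 : 0 < a) (b0 : 0 < b) (H0 : 0 < H).
Hypothesis HN : is_network lam_l lam a b H N.

Local Notation P := (net_prob N).
Local Notation q := (1 - p_los_min a b).

Local Notation idle := (idle_event (N := N) rs).
Local Notation sig := (positions_sigma (N := N)).

Let q_ge0 : 0 <= q.
Proof. by rewrite subr_ge0 ltW// p_los_min_lt1. Qed.

Lemma on_road_diskE o (rho x : R) :
  disk rs (on_road o rho x) <-> rho ^+ 2 + x ^+ 2 <= rs ^+ 2.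
Proof.
rewrite /disk /norm2 /=.
have -> : (on_road o rho x).1 ^+ 2 + (on_road o rho x).2 ^+ 2 = rho ^+ 2 + x ^+ 2.
  by case: o => //=; rewrite addrC.
rewrite -{1}(gtr0_norm rs0) -sqrtr_sqr ler_sqrt ?sqr_ge0//.
Qed.

Lemma positions_sigma_component c :
  sigma_of (component_points N c) `<=` sig.
Proof.
exact: (@sigma_of_comp _ _ _ _ _ _
  (fun p : component * nat => component_points N p.1 p.2) (pair c)).
Qed.

Lemma positions_sigma_measurable : sig `<=` measurable.
Proof. exact: sigma_of_measurable. Qed.

(** The constraint put by one vehicle is measurable through its squared distance to the origin, and
    there are countably many vehicles. *)
Lemma measurable_idle_event : measurable idle.
Proof.
pose E s := [set w | disk rs (vehicle_position (N:=N) s w) -> ~ detectable N s w].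
have mE s : measurable (E s).
  rewrite [E s](_ : _ = ~` [set w | disk rs (vehicle_position s w)]
                      `|` ~` detectable N s); last first.
    by apply/funext => w; rewrite /E/= implyE.
  apply: measurableU; apply: measurableC; last exact: (net_detectable_measurable HN).
  case: s => [[ori i] k] /=.
  rewrite [X in measurable X](_ : _ =
    (fun w => road N ori i w ^+ 2 + vehicle N ori i k w ^+ 2) @^-1` `]-oo, rs ^+ 2]).
    rewrite -[X in measurable X]setTI.
    have : measurable_fun setT
        (fun w => road N ori i w ^+ 2 + vehicle N ori i k w ^+ 2).
      by apply: measurable_funD; apply: measurable_funX.
    by apply => //; exact: measurable_itv.
  apply/seteqP; split=> w /=; rewrite in_itv/=; by move/on_road_diskE.
rewrite [X in measurable X](_ : _ =
  (\bigcap_i \bigcap_k E (Horizontal, i, k)) `&`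
  (\bigcap_i \bigcap_k E (Vertical, i, k))).
  by apply: measurableI; apply: bigcap_measurableType => i _;
    apply: bigcap_measurableType => k _.
apply/seteqP; split=> w.
  by move=> idlew; split=> i _ k _; exact: idlew.
by move=> [idleH idleV] [[[] i] k]; [exact: idleH|exact: idleV].
Qed.

(** Given the positions, distinct vehicles are detected independently, each being missed with
    probability at most [q]; the product of these bounds is integrated over [A]. *)
Lemma undetected_le n (s : 'I_n -> orientation * nat * nat) A :
  injective s -> sig A ->
  (P (A `&` \bigcap_j ~` detectable N (s j)) <= (q ^+ n)%:E * P A)%E.
Proof.
move=> injs sA; rewrite (net_detectable HN injs (fun=> false) sA).
rewrite -(integral_cst P (positions_sigma_measurable _ sA)).
apply: ge0_le_integral_nomeas => w _; rewrite lee_fin.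
  by apply: prodr_ge0 => j _; rewrite subr_ge0 p_los_le1.
rewrite -[n in q ^+ n]card_ord -prodr_const; apply: ler_prod => j _.
by rewrite subr_ge0 p_los_le1//= lerD2l lerN2 p_los_ge// sqrtr_ge0.
Qed.

(** Union bound: either one of the [n] windows carries no vehicle, or every window is hit and [n]
    distinct vehicles of the disk all go undetected. Since [F] depends on the roads only, it is
    independent of the vehicles of road [i]. *)
Lemma idle_road_le o i F r n : 0 < r < rs -> (0 < n)%N ->
  sigma_of (road N o) F -> F `<=` [set w | `|road N o i w| <= r] ->
  (P (F `&` idle) <=
   (n%:R * expR (- (lam * (Num.sqrt (rs ^+ 2 - r ^+ 2) / n%:R))) + q ^+ n)%:E
     * P F)%E.
Proof.
move=> /andP[r0 rrs] n0 sF Fr.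
set delta := Num.sqrt _.
have rrs2 : 0 < rs ^+ 2 - r ^+ 2 by rewrite subr_gt0 ltr_pXn2r// nnegrE ltW.
have d0 : 0 < delta by rewrite sqrtr_gt0.
have d2 : delta ^+ 2 = rs ^+ 2 - r ^+ 2 by rewrite sqr_sqrtr// ltW.
pose V := vehicle N o i; pose W := window delta n.
have mW j : measurable (W j) by exact: measurable_itv.
have mF : measurable F := sigma_of_measurable _ sF.
have sV A : sigma_of V A -> sig A.
  exact: (positions_sigma_component (Vehicles o i)).
have sF' : sig F := positions_sigma_component (Roads o) _ sF.
have mavoids j : measurable (avoids V (W j)).
  by apply: sigma_of_measurable; exact: sigma_of_avoids.
(* [F] and the void event belong to different components of the network, so their probabilities
   multiply. *)
have avoids_le j : (P (F `&` avoids V (W j)) =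
    (expR (- (lam * (delta / n%:R))))%:E * P F)%E.
  rewrite (mutually_independent2 (Roads o) (Vehicles o i) _ _
    (net_independent HN))//; last exact: sigma_of_avoids.
  have WE : lebesgue_measure (W j) = (delta / n%:R)%:E by exact: window_measure.
  by have := poisson_avoids (net_vehicles HN o i) (mW j); rewrite WE ltry
    => /(_ isT) ->; rewrite muleC.
pose hit := \bigcap_(j in `I_n) ~` avoids V (W j).
have mhit : measurable hit.
  by apply: bigcap_measurableType => j _; exact: measurableC.
have hit_le : (P (F `&` hit `&` idle) <= (q ^+ n)%:E * P F)%E.
  (* [k j] is the index of the first vehicle in window [j]. Finite functions into [nat] are
     countably many, so the pieces can be summed over [k]. *)
  pose K (k : {ffun 'I_n -> nat}) := \bigcap_(j : 'I_n) first_hit V (W j) (k j).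
  have sK k : sigma_of V (K k).
    by apply: sigma_of_bigcap_fin => j; exact: sigma_of_first_hit.
  have sFK k : sig (F `&` K k) by apply: sigma_ofI => //; exact: sV.
  have -> : F `&` hit `&` idle =
      \bigcup_k (F `&` K k `&` idle).
    rewrite -setI_bigcupl; congr (_ `&` _); rewrite -setI_bigcupr; congr (_ `&` _).
    apply/seteqP; split=> w.
      move=> hitw.
      have /choice[k kP] (j : 'I_n) : exists m, first_hit V (W j) m w.
        have [m _ hm] : (\bigcup_m first_hit V (W j) m) w.
          by rewrite first_hitE; exact: hitw (ltn_ord j).
        by exists m.
      by exists [ffun j => k j] => // j _; rewrite ffunE; exact: kP.
    move=> [k _ Kw] j /= jn.
    suff : (\bigcup_m first_hit V (W j) m) w by rewrite first_hitE.
    by exists (k (Ordinal jn)) => //; exact: (Kw (Ordinal jn)).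
  apply: (@measure_bigcup_pieces _ _ _ _ _ _ (fun k => F `&` K k)) => //.
  - by rewrite exprn_ge0.
  - move=> k; apply: measurableI; last exact: measurable_idle_event.
    exact: positions_sigma_measurable.
  - by move=> k; exact: positions_sigma_measurable.
  - move=> k k' _ _ [w [[_ Kw] [_ K'w]]]; apply/ffunP => j.
    apply: (@trivIset_seqDU _ (fun m => V m @^-1` W j)) => //.
    by exists w; split; [exact: Kw|exact: K'w].
  - move=> k.
    have inW w (j : 'I_n) : K k w -> W j (V (k j) w).
      by move=> Kw; exact: (@subset_seqDU _ (fun m => V m @^-1` W j) _ _ (Kw j Logic.I)).
    have [injk|/existsNP[j /existsNP[j' /not_implyP[kjj' jj']]]] :=
      pselect (injective k); last first.
      rewrite [X in P X](_ : _ = set0) ?measure0 ?mule_ge0 ?lee_fin ?exprn_ge0//.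
      apply/seteqP; split => // w [[_ Kw] _]; apply: jj'; apply/val_inj.
      have := inW w j' Kw; rewrite -kjj'; apply: (window_inj d0 n0); exact: inW.
    pose s (j : 'I_n) : orientation * nat * nat := (o, i, k j).
    have injs : injective s by move=> j j' [] /injk.
    apply: le_trans (undetected_le _ _ _ injs (sFK k)).
    apply: le_measure; rewrite ?inE.
    + apply: measurableI; last exact: measurable_idle_event.
      exact: positions_sigma_measurable.
    + apply: measurableI; first exact: positions_sigma_measurable.
      apply: fin_bigcap_measurable => [|j _]; first exact: finite_finset.
      by apply: measurableC; exact: net_detectable_measurable HN _.
    + move=> w [[Fw Kw] idlew]; split=> // j _; apply: idlew.
      (* The road coordinate is at most [r] and the abscissa at most [delta] in absolute value; by
         the choice of [delta] the squares add up to at most [rs ^+ 2]. *)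
      apply/on_road_diskE.
      have /andP[V0 Vd] := window_sub d0 (ltn_ord j) (inW w j Kw).
      have : vehicle N o i (k j) w ^+ 2 <= delta ^+ 2.
        by rewrite ler_pXn2r// nnegrE ltW.
      have : road N o i w ^+ 2 <= r ^+ 2.
        have r0' := ltW r0; rewrite -(real_normK (num_real (road N o i w))).
        by rewrite ler_pXn2r ?nnegrE//; exact: Fr.
      rewrite d2; lra.
(* The cover has [n.+1] events: an empty window for each index below [n], and the case where all
   windows are hit at index [n]. *)
pose G j := if (j < n)%N then F `&` avoids V (W j) else F `&` hit `&` idle.
have mG j : measurable (G j).
  rewrite /G; case: ifP => _; first exact: measurableI.
  by apply: measurableI; [exact: measurableI|exact: measurable_idle_event].
apply: (@le_trans _ _ (\sum_(j < n.+1) P (G j))%E).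
  apply: content_subadditive => //.
    by apply: measurableI => //; exact: measurable_idle_event.
  rewrite -bigcup_mkord => w [Fw idlew].
  have [hitw|/existsNP[j /not_implyP[/= jn /contrapT vw]]] := pselect (hit w).
    by exists n => /=; rewrite ?ltnSn// /G ltnn.
  by exists j => /=; [rewrite (ltn_trans jn)|rewrite /G jn].
rewrite big_ord_recr/= EFinD ge0_muleDl ?lee_fin ?mulr_ge0 ?expR_ge0 ?exprn_ge0//.
rewrite leeD//; last by rewrite /G ltnn.
under eq_bigr do rewrite /G ltn_ord avoids_le.
rewrite -(@fineK _ (P F)) ?fin_num_measure//.
under eq_bigr do rewrite -EFinM.
by rewrite sumEFin sumr_const card_ord -EFinM -mulrA mulr_natl.
Qed.

End network_bounds.

(** * Two-sided bounds on the idle probability, and the probability that a road meets the disk *)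

Section idle_bounds.
Context {R : realType} {lam_l lam a b H rs : R} {N : network R}.
Hypotheses (rs0 : 0 < rs) (a0 : 0 < a) (b0 : 0 < b) (H0 : 0 < H).
Hypothesis HN : is_network lam_l lam a b H N.

Local Notation P := (net_prob N).
Local Notation idle := (idle_event (N := N) rs).

Definition no_road (N' : network R) (r : R) : set (net_space N') :=
  avoids (road N' Horizontal) `[- r, r]%classic `&`
  avoids (road N' Vertical) `[- r, r]%classic.

Lemma measurable_avoids_road o r :
  measurable (avoids (road N o) `[- r, r]%classic).
Proof.
by apply: sigma_of_measurable; apply: sigma_of_avoids; exact: measurable_itv.
Qed.

Lemma measurable_no_road r : measurable (no_road N r).
Proof. by apply: measurableI; exact: measurable_avoids_road. Qed.

(** The two orientations are independent, and each has to avoid an interval of length [2 * r]. *)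
Lemma prob_no_road r : 0 < r ->
  P (no_road N r) = (expR (- (4 * lam_l * r)))%:E.
Proof.
move=> r0.
have Pavoid o :
    P (avoids (road N o) `[- r, r]%classic) = (expR (- (lam_l * (r + r))))%:E.
  have Ir : lebesgue_measure `[- r, r]%classic = (r + r)%:E.
    by rewrite lebesgue_measure_itv/= lte_fin gtrN// -EFinD opprK.
  have := poisson_avoids (net_roads HN o) (measurable_itv `[- r, r]).
  by rewrite Ir ltry => /(_ isT) ->.
rewrite (mutually_independent2 (Roads Horizontal) (Roads Vertical) _ _
  (net_independent HN))//.
- by rewrite !Pavoid -EFinM -expRD; congr (expR _)%:E; ring.
- by apply: sigma_of_avoids; exact: measurable_itv.
- by apply: sigma_of_avoids; exact: measurable_itv.
- exact: measurable_avoids_road.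
- exact: measurable_avoids_road.
Qed.

(** The bound of [idle_road_le] does not depend on the road, so it survives summation over the index
    of the first road in the interval. *)
Lemma idle_with_road_le o r n : 0 < r < rs -> (0 < n)%N ->
  (P (~` avoids (road N o) `[(- r)%R, r]%classic `&` idle) <=
   (n%:R * expR (- (lam * (Num.sqrt (rs ^+ 2 - r ^+ 2) / n%:R)))
     + (1 - p_los_min a b) ^+ n)%:E)%E.
Proof.
move=> rrs n0; set c := _ + _.
have c0 : 0 <= c.
  rewrite addr_ge0 ?mulr_ge0 ?expR_ge0// exprn_ge0// subr_ge0 ltW//.
  exact: p_los_min_lt1.
pose A := first_hit (road N o) `[- r, r]%classic.
have sA i : sigma_of (road N o) (A i).
  by apply: sigma_of_first_hit; exact: measurable_itv.
have mA i := sigma_of_measurable _ (sA i).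
(* The right-hand side is multiplied by the probability of the whole space, which contains all the
   pieces. *)
rewrite -first_hitE setI_bigcupl -[leRHS]mule1 -(probability_setT P).
apply: (@measure_bigcup_pieces _ _ _ _ _ _ A) => //.
- by move=> i; apply: measurableI => //; exact: measurable_idle_event HN.
- exact: trivIset_seqDU.
- move=> i; apply: (@idle_road_le _ _ _ _ _ _ _ _ rs0 a0 b0 H0 HN o i) => // w Aw.
  have := @subset_seqDU _ (fun m => road N o m @^-1` `[- r, r]%classic) _ _ Aw.
  by rewrite /= in_itv/= ler_norml; exact.
Qed.

(** An idle UAV either has no road within [r], or has such a road of one of the two orientations,
    whence the factor 2. *)
Lemma p_idle_le r n : 0 < r < rs -> (0 < n)%N ->
  p_idle rs N <= expR (- (4 * lam_l * r)) +
    2 * (n%:R * expR (- (lam * (Num.sqrt (rs ^+ 2 - r ^+ 2) / n%:R)))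
      + (1 - p_los_min a b) ^+ n).
Proof.
move=> rrs n0; set c := _ + (1 - _) ^+ n.
have [r0 _] := andP rrs.
have midle := measurable_idle_event rs0 HN.
pose B o := ~` avoids (road N o) `[- r, r]%classic `&` idle.
have mB o : measurable (B o).
  by apply: measurableI => //; apply: measurableC; exact: measurable_avoids_road.
rewrite -lee_fin /p_idle fineK ?fin_num_measure//.
have idleU : idle `<=` no_road N r `|` (B Horizontal `|` B Vertical).
  move=> w idlew.
  have [?|?] := pselect (avoids (road N Horizontal) `[- r, r]%classic w);
    last by right; left.
  by have [?|?] := pselect (avoids (road N Vertical) `[- r, r]%classic w);
    [left|right; right].
have mBB := measurableU _ _ (mB Horizontal) (mB Vertical).
have mno := measurable_no_road r.
apply: (@le_trans _ _ (P (no_road N r `|` (B Horizontal `|` B Vertical)))).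
  by apply: le_measure; rewrite ?inE//; exact: measurableU.
apply: (le_trans (measureU2 P mno mBB)).
rewrite EFinD -prob_no_road// leeD2l// (le_trans (measureU2 P (mB _) (mB _)))//.
by rewrite mulr_natl mulr2n EFinD leeD// idle_with_road_le.
Qed.

(** A vehicle in the disk lies on a road whose coordinate is at most [rs] in absolute value. *)
Lemma no_road_idle : no_road N rs `<=` idle.
Proof.
move=> w [noH noV] [[ori i] k] /on_road_diskE => /(_ rs0) road_disk _.
have : `|road N ori i w| <= rs.
  rewrite -(ler_pXn2r (n := 2))// ?nnegrE ?(ltW rs0)// real_normK ?num_real//.
  by apply: le_trans road_disk; rewrite lerDl sqr_ge0.
rewrite ler_norml => rr.
by case: ori {road_disk} rr => rr;
  [apply: (noH i Logic.I)|apply: (noV i Logic.I)]; rewrite /= in_itv.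
Qed.

Lemma p_idle_ge : expR (- (4 * lam_l * rs)) <= p_idle rs N.
Proof.
have midle := measurable_idle_event rs0 HN.
rewrite -lee_fin -prob_no_road// /p_idle fineK ?fin_num_measure//.
by apply: le_measure; rewrite ?inE//; [exact: measurable_no_road|exact: no_road_idle].
Qed.

(** The point of a road nearest to the origin has abscissa 0, so the road meets the disk exactly
    when its coordinate lies in [[- rs, rs]]. *)
Lemma road_in_diskE : road_in_disk (N := N) rs = ~` no_road N rs.
Proof.
have roadE o i w : road_line o (road N o i w) `&` disk rs !=set0 <->
    `[- rs, rs]%classic (road N o i w).
  rewrite /= in_itv/= -ler_norml; split.
    move=> [p [lp dp]].
    have [x px] : exists x, p = on_road o (road N o i w) x.
      case: o lp {dp}; case: p => [p1 p2] /= ->; by [exists p1|exists p2].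
    move: dp; rewrite px => /(on_road_diskE rs0) rx.
    rewrite -(ler_pXn2r (n := 2))// ?nnegrE ?(ltW rs0)// real_normK ?num_real//.
    by apply: le_trans rx; rewrite lerDl sqr_ge0.
  move=> rr; exists (on_road o (road N o i w) 0); split; first by case: o {rr}.
  apply/(on_road_diskE rs0); rewrite expr0n addr0 -real_normK ?num_real//.
  by rewrite ler_pXn2r ?nnegrE// ltW.
apply/seteqP; split=> w.
  by move=> [[] [i /roadE ir]] [noH noV]; [exact: (noH i)|exact: (noV i)].
rewrite /no_road setCI => -[]; rewrite /avoids setC_bigcap => -[i _ /contrapT ir].
  by exists Horizontal, i; apply/roadE.
by exists Vertical, i; apply/roadE.
Qed.

Lemma p_road_in_diskE : p_road_in_disk rs N = 1 - expR (- (4 * lam_l * rs)).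
Proof.
rewrite /p_road_in_disk road_in_diskE probability_setC; last first.
  exact: measurable_no_road.
by rewrite prob_no_road.
Qed.

End idle_bounds.

(** Finiteness of the larger integral matters because [fine] sends an infinite value to 0. *)
Lemma le_Rintegral_nomeas {d} {T : measurableType d} {R : realType}
    {mu : {measure set T -> \bar R}} {D : set T} {f g : T -> R} :
  (forall x, D x -> 0 <= f x) -> (forall x, D x -> f x <= g x) ->
  (\int[mu]_(x in D) (g x)%:E < +oo)%E ->
  \int[mu]_(x in D) f x <= \int[mu]_(x in D) g x.
Proof.
move=> f0 fg goo.
have fge : (\int[mu]_(x in D) (f x)%:E <= \int[mu]_(x in D) (g x)%:E)%E.
  by apply: ge0_le_integral_nomeas => x Dx; rewrite lee_fin; [exact: f0|exact: fg].
have fe0 : (0 <= \int[mu]_(x in D) (f x)%:E)%E.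
  by apply: integral_ge0 => x Dx; rewrite lee_fin; exact: f0.
apply: fine_le => //; rewrite ge0_fin_numE//; first exact: le_lt_trans goo.
exact: le_trans fge.
Qed.

(** * Estimates for the closed form *)

Section closed_form.
Context {R : realType} {lam_l lam a b H rs : R}.
Hypotheses (lam0 : 0 < lam) (rs0 : 0 < rs).
Hypotheses (a0 : 0 < a) (b0 : 0 < b) (H0 : 0 < H).

Let p0 := p_los_min a b.

Lemma lebesgue_measure_0itv (s : R) : 0 <= s ->
  lebesgue_measure `[0, s]%classic = s%:E.
Proof.
rewrite lebesgue_measure_itv/= lte_fin le_eqVlt => /predU1P[<-|->].
  by rewrite ltxx.
by rewrite oppr0 adde0.
Qed.

Lemma integral_cst_0itv_lty (s M : R) : 0 <= s ->
  (\int[lebesgue_measure]_(x in `[0%R, s]) M%:E < +oo)%E.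
Proof.
by move=> s0; rewrite integral_cst//= lebesgue_measure_0itv// -EFinM ltry.
Qed.

Lemma Lambda_ge0 rho : 0 <= Lambda lam a b H rs rho.
Proof.
rewrite mulr_ge0// Rintegral_ge0// => x _.
by rewrite mulr_ge0 ?(ltW lam0)// (le_trans _ (p_los_ge a0 b0 H0 _ _)) ?sqrtr_ge0//
  ltW// p_los_min_gt0.
Qed.

(** A chord at distance at most [r] from the centre has half-length at least [sqrt (rs^2 - r^2)],
    and the integrand is at least [lam * p0] along it. *)
Lemma Lambda_ge r rho : 0 <= rho <= r ->
  2 * (lam * p0 * Num.sqrt (rs ^+ 2 - r ^+ 2)) <= Lambda lam a b H rs rho.
Proof.
move=> /andP[rho0 rhor]; rewrite /Lambda ler_pM2l//.
set s := Num.sqrt (rs ^+ 2 - rho ^+ 2).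
have s0 : 0 <= s := sqrtr_ge0 _.
have lp0 : 0 <= lam * p0 by rewrite mulr_ge0 ?ltW// p_los_min_gt0.
apply: (@le_trans _ _ (\int[lebesgue_measure]_(x in `[0, s]) (lam * p0))).
  rewrite Rintegral_cst//= lebesgue_measure_0itv//= ler_wpM2l//.
  by rewrite ler_wsqrtr// lerD2l lerN2 ler_pXn2r// nnegrE// (le_trans rho0).
apply: le_Rintegral_nomeas => // [x _|].
  by rewrite ler_pM2l// p_los_ge// sqrtr_ge0.
apply: le_lt_trans (integral_cst_0itv_lty s lam s0).
apply: ge0_le_integral_nomeas => x _; rewrite lee_fin.
  apply: le_trans lp0 _.
  by rewrite ler_pM2l// p_los_ge// sqrtr_ge0.
by rewrite ger_pMr// p_los_le1.
Qed.

(** The integrand is exponentially small on [[0, r]] by [Lambda_ge] and at most 1 beyond; a constant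
    plus the indicator of []r, rs]] dominates it throughout. *)
Lemma integral_exp_Lambda_le r : 0 < r < rs ->
  \int[lebesgue_measure]_(rho in `[0, rs]) expR (- Lambda lam a b H rs rho) <=
  expR (- (lam * (2 * p0 * Num.sqrt (rs ^+ 2 - r ^+ 2)))) * rs + (rs - r).
Proof.
move=> /andP[r0 rrs]; set c := expR (- (lam * _)).
have mI : measurable (`]r, rs]%classic : set R) by exact: measurable_itv.
have Ig : (\int[lebesgue_measure]_(x in `[0%R, rs])
    ((c + \1_(`]r, rs]%classic) x)%R)%:E <= (c * rs + (rs - r))%:E)%E.
  under eq_integral do rewrite EFinD.
  rewrite ge0_integralD//; last 2 first.
  - by move=> x _; rewrite lee_fin expR_ge0.
  - by apply/measurable_EFinP; exact: measurable_indic.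
  rewrite integral_cst//= lebesgue_measure_0itv ?(ltW rs0)//.
  rewrite integral_indic// EFinD -EFinM leeD2l//.
  have <- : lebesgue_measure (`]r, rs]%classic : set R) = (rs - r)%:E.
    by rewrite lebesgue_measure_itv/= lte_fin rrs.
  by apply: le_measure; rewrite ?inE//; exact: measurableI.
apply: le_trans (_ : fine (\int[lebesgue_measure]_(x in `[0%R, rs])
    ((c + \1_(`]r, rs]%classic) x)%R)%:E) <= _).
  apply: le_Rintegral_nomeas => [x _|x|]; first exact: expR_ge0.
    rewrite /= in_itv/= => /andP[x0 xrs].
    have [xr|rx] := leP x r.
      rewrite -[leLHS]addr0 lerD// ler_expR lerN2.
      apply: le_trans (Lambda_ge r x _); last by rewrite x0.
      by rewrite le_eqVlt; apply/orP; left; apply/eqP; ring.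
    rewrite indicE mem_set/= ?in_itv/= ?rx//.
    rewrite -[leLHS]add0r lerD ?expR_ge0// -expR0 ler_expR oppr_le0.
    exact: Lambda_ge0.
  exact: le_lt_trans Ig (ltry _).
rewrite -lee_fin fineK// ge0_fin_numE; first exact: le_lt_trans Ig (ltry _).
by apply: integral_ge0 => x _; rewrite lee_fin addr_ge0 ?expR_ge0.
Qed.

End closed_form.

(** * Limits as the vehicular density tends to infinity *)

Section limits.
Context {R : realType}.

(** From [expR x >= 1 + x], it suffices that [lam >= C / (eta * k)]. *)
Lemma near_expRN_le (C k eta : R) : 0 <= C -> 0 < k -> 0 < eta ->
  \forall lam \near +oo, C * expR (- (lam * k)) <= eta.
Proof.
move=> C0 k0 eta0; near=> lam.
rewrite expRN ler_pdivrMr ?expR_gt0//.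
have Clam : C / (eta * k) <= lam by near: lam; apply: nbhs_pinfty_ge; rewrite num_real.
have Clamk : C <= eta * (lam * k).
  by move: Clam; rewrite ler_pdivrMr ?mulr_gt0// mulrCA.
apply: (le_trans Clamk); rewrite ler_pM2l//.
by apply: le_trans (expR_ge1Dx _); rewrite lerDr.
Unshelve. all: by end_near. Qed.

Lemma cvg_p_idle (lam_l rs a b H : R) (N : R -> network R) :
  0 < rs -> 0 < a -> 0 < b -> 0 < H ->
  (forall lam, 0 < lam -> is_network lam_l lam a b H (N lam)) ->
  p_idle rs (N lam) @[lam --> +oo] --> expR (- (4 * lam_l * rs)).
Proof.
move=> rs0 a0 b0 H0 HN.
set e := expR _; set q := 1 - p_los_min a b.
apply/cvgrPdist_le => eps eps0.
(* Error budget: [eps / 2] for replacing [rs] by [r], and [eps / 8] for each of the two terms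
   doubled in [p_idle_le]. The radius is fixed first, then [n], and [lam] last. *)
have eps2 : 0 < eps / 2 by rewrite divr_gt0.
have eps8 : 0 < eps / 8 by rewrite divr_gt0.
have [r rrs er] : exists2 r, 0 < r < rs & expR (- (4 * lam_l * r)) <= e + eps / 2.
  (* Continuity at [rs] is restricted to the left, where [r < rs] leaves a segment of positive
     length inside the disk. *)
  have : expR (- (4 * lam_l * r)) @[r --> rs] --> e.
    apply: (@continuous_comp _ _ _ (fun r => - (4 * lam_l * r)) expR).
      by apply: cvgN; apply: cvgMr; exact: cvg_id.
    exact: continuous_expR.
  move=> /(@cvg_at_left_filter _ _ _ _ _)/cvgrPdist_le/(_ _ eps2) near_e.
  have near_r : \forall r \near rs^'-, 0 < r < rs.
    near=> r; apply/andP; split; last by near: r; exact: nbhs_left_lt.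
    by near: r; exact: nbhs_left_gt.
  have [r [re rr]] := filter_ex (filterI near_e near_r).
  by exists r => //; move: re; rewrite ler_norml; lra.
have q01 : `|q| < 1.
  have := p_los_min_gt0 (b := b) a0; have := p_los_min_lt1 (b := b) a0.
  by rewrite ltr_norml /q; lra.
have [n [qn n0]] : exists n, q ^+ n <= eps / 8 /\ (0 < n)%N.
  have /cvgrPdist_le/(_ _ eps8) near_q := cvg_expr q01.
  have [n [qn n0]] := filter_ex (filterI near_q (nbhs_infty_gt 0%N)).
  by exists n; split => //; move: qn; rewrite sub0r normrN ler_norml => /andP[].
set k := Num.sqrt (rs ^+ 2 - r ^+ 2) / n%:R.
have k0 : 0 < k.
  case/andP: rrs => r0 rrs.
  by rewrite divr_gt0 ?ltr0n// sqrtr_gt0 subr_gt0 ltr_pXn2r// nnegrE ltW.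
near=> lam.
have lam0 : 0 < lam by near: lam; apply: nbhs_pinfty_gt; rewrite num_real.
have := p_idle_ge rs0 (HN _ lam0).
have := p_idle_le rs0 a0 b0 H0 (HN _ lam0) r n rrs n0.
have : n%:R * expR (- (lam * k)) <= eps / 8.
  by near: lam; exact: near_expRN_le.
rewrite -/e -/q -/k ler_norml; lra.
Unshelve. all: by end_near. Qed.

(** Argued on the formula alone, without the network: the integral vanishes in the limit, leaving
    [- rs] in the exponent. *)
Lemma cvg_p_idle_closed_form (lam_l rs a b H : R) :
  0 < rs -> 0 < a -> 0 < b -> 0 < H ->
  p_idle_closed_form lam_l lam a b H rs @[lam --> +oo] -->
    expR (- (4 * lam_l * rs)).
Proof.
move=> rs0 a0 b0 H0; rewrite /p_idle_closed_form.
have I0 : \int[lebesgue_measure]_(rho in `[0, rs])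
    expR (- Lambda lam a b H rs rho) @[lam --> +oo] --> (0 : R).
  apply/cvgrPdist_le => eps eps0.
  (* The second argument keeps [rs - r] within [eps / 2]; the first keeps [r] positive when [eps] is
     large. *)
  pose r := Num.max (rs / 2) (rs - eps / 2).
  have rrs : 0 < r < rs.
    rewrite lt_max gt_max.
    by apply/andP; split; [apply/orP; left|apply/andP; split]; lra.
  have rs_r : rs - r <= eps / 2 by rewrite lerBlDr addrC -lerBlDr le_max lexx orbT.
  have k0 : 0 < 2 * p_los_min a b * Num.sqrt (rs ^+ 2 - r ^+ 2).
    case/andP: rrs => r0 rrs.
    by rewrite !mulr_gt0 ?p_los_min_gt0// sqrtr_gt0 subr_gt0 ltr_pXn2r// nnegrE ltW.
  near=> lam.
  have lam0 : 0 < lam by near: lam; apply: nbhs_pinfty_gt; rewrite num_real.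
  rewrite sub0r normrN ger0_norm; last by apply: Rintegral_ge0 => x _; exact: expR_ge0.
  apply: le_trans (integral_exp_Lambda_le lam0 rs0 a0 b0 H0 r rrs) _.
  rewrite [leRHS]splitr lerD// mulrC; near: lam.
  by apply: near_expRN_le => //; [exact: ltW|rewrite divr_gt0].
have -> : - (4 * lam_l * rs) = 4 * lam_l * (0 - rs) by ring.
apply: continuous_cvg; first exact: continuous_expR.
by apply: cvgMr; apply: cvgB => //; exact: cvg_cst.
Unshelve. all: by end_near. Qed.

End limits.

Theorem mainTheorem9 (R : realType) (lam_l rs a b H : R)
    (lam_l_gt0 : 0 < lam_l) (rs_gt0 : 0 < rs)
    (a_gt0 : 0 < a) (b_gt0 : 0 < b) (H_gt0 : 0 < H)
    (N : R -> network R)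
    (HN : forall lam : R, 0 < lam -> is_network lam_l lam a b H (N lam)) :
  [/\ p_idle rs (N lam) @[lam --> +oo] --> expR (- (4 * lam_l * rs)),
      p_idle_closed_form lam_l lam a b H rs @[lam --> +oo] -->
        expR (- (4 * lam_l * rs)),
      p_active rs (N lam) @[lam --> +oo] --> 1 - expR (- (4 * lam_l * rs)) &
      forall lam : R, 0 < lam ->
        p_road_in_disk rs (N lam) = 1 - expR (- (4 * lam_l * rs))].
Proof.
have idle_cvg := @cvg_p_idle _ _ _ _ _ _ _ rs_gt0 a_gt0 b_gt0 H_gt0 HN.
split => //.
- exact: cvg_p_idle_closed_form.
- by apply: cvgB => //; exact: cvg_cst.
- by move=> lam lam0; exact: (p_road_in_diskE rs_gt0 (HN _ lam0)).
Qed.
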